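(* Let $R$ be a commutative integral domain such that every singular $2\times 2$ matrix with entries in $R$ is a product of idempotent matrices (with entries in $R$). Then $R$ is a Prüfer domain, and every invertible $2\times 2$ matrix with entries in $R$ is a product of elementary matrices (with entries in $R$).
   Context: A matrix over an integral domain is singular if its determinant is $0$. A square matrix $E$ is idempotent if $E^2=E$. A Prüfer domain is an integral domain in which every nonzero finitely generated ideal is invertible. Elementary matrices are the invertible matrices corresponding to elementary row operations: matrices differing from the identity in one off-diagonal entry, permutation (row-swap) matrices, and matrices obtained from the identity by replacing a diagonal entry with a unit of $R$ (so invertible diagonal matrices are products of elementary matrices). *)

(* Defs.v *)
From mathcomp Require Import all_boot all_order all_algebra.
From mathcomp Require Import classical_sets.

Set Implicit Arguments.
Unset Strict Implicit.
Unset Printing Implicit Defensive.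

Import GRing.Theory.
Local Open Scope classical_set_scope.
Local Open Scope ring_scope.

(* The embedding of R into its fraction field (the library's notation for it
   is local to fraction.v). *)
Notation "x %:F" := (@FracField.tofrac _ x) : ring_scope.

Definition is_product_of (M : pzSemiRingType) (P : M -> Prop) (x : M) : Prop :=
  exists2 s : seq M, (forall y, y \in s -> P y) & x = \prod_(y <- s) y.

Definition singular_mx (R : comPzRingType) n (A : 'M[R]_n) : Prop := \det A = 0.

Definition idempotent_mx (R : pzRingType) n (E : 'M[R]_n) : Prop := E *m E = E.

Inductive elementary_mx (R : comUnitRingType) n : 'M[R]_n -> Prop :=
| elementary_transvection (i j : 'I_n) (a : R) :
    i != j -> elementary_mx (1%:M + a *: delta_mx i j)
| elementary_swap (i j : 'I_n) :
    elementary_mx (tperm_mx i j)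
| elementary_dilation (i : 'I_n) (u : R) :
    u \is a GRing.unit ->
    elementary_mx (diag_mx (\row_k (if k == i then u else 1))).

Section Prufer.
Variable R : idomainType.

Definition fg_ideal (s : seq R) : set R :=
  [set x | exists c : 'I_(size s) -> R, x = \sum_i c i * s`_i].

Definition submodule_frac (J : set {fraction R}) : Prop :=
  [/\ J 0, (forall x y, J x -> J y -> J (x + y))
    & (forall (r : R) x, J x -> J (r%:F * x))].

Definition fractional_ideal (J : set {fraction R}) : Prop :=
  submodule_frac J /\
  exists2 d : R, d != 0 & forall x, J x -> exists r : R, d%:F * x = r%:F.

Definition mul_frac (I J : set {fraction R}) : set {fraction R} :=
  [set x | exists (n : nat) (a b : 'I_n -> {fraction R}),
     [/\ (forall k, I (a k)), (forall k, J (b k)) & x = \sum_k a k * b k]].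

Definition invertible_ideal (I : set R) : Prop :=
  exists2 J : set {fraction R}, fractional_ideal J
    & mul_frac [set x%:F | x in I] J = [set x%:F | x in [set: R]].

Definition prufer_domain : Prop :=
  forall s : seq R, fg_ideal s <> [set 0] -> invertible_ideal (fg_ideal s).

End Prufer.

(* Main.v *)
Require Import Defs.
From mathcomp Require Import all_boot all_order all_algebra.
From mathcomp Require Import perm boolp classical_sets ring.

(**
Let [a, b] be in [R], not both zero, and write the singular matrix with rows [(a, b)] and [0]
as a product of idempotents. The last factor [E] different from [1] is
singular and fixes [(a, b)], hence has trace [1]; so its diagonal entries
[e, f] satisfy [e + f = 1], [e b \in a R] and [f a \in b R]. By induction on
the number of generators, [a_0, ..., a_n] admit a partition of unity [e_i] with
[e_i a_j \in a_i R], and the fractions [e_i / a_i] then generate the inverse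
of the ideal [(a_0, ..., a_n)].

If [(a, b)] is the first row of an invertible matrix, then
[(a, b) = (1, 0) E_1 ... E_n] with the [E_i] idempotent, and [(a, b) u = 1] for
some column [u]. Put [r_i = (1, 0) E_1 ... E_i] and [c_i = E_i ... E_n u].
Idempotency of [E_i] gives [r_(i-1) c_i = r_i c_i = 1]. So two transvections
carry a completion of the row [r_(i-1)] to a product of elementary matrices
over to the column [c_i], and then to the row [r_i].
*)

Set Implicit Arguments.
Unset Strict Implicit.
Unset Printing Implicit Defensive.

Import GRing.Theory.
Local Open Scope ring_scope.

Lemma is_product_of_mul (M : pzSemiRingType) (P : M -> Prop) (x y : M) :
  is_product_of P x -> is_product_of P y -> is_product_of P (x * y).
Proof.
move=> [s Ps ->] [t Pt ->]; exists (s ++ t); last by rewrite big_cat.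
by move=> z; rewrite mem_cat => /orP[/Ps|/Pt].
Qed.

Lemma is_product_of1 (M : pzSemiRingType) (P : M -> Prop) : is_product_of P 1.
Proof. by exists [::]; rewrite ?big_nil. Qed.

Lemma is_product_of_gen (M : pzSemiRingType) (P : M -> Prop) (x : M) :
  P x -> is_product_of P x.
Proof.
move=> Px; exists [:: x]; last by rewrite big_seq1.
by move=> y; rewrite inE => /eqP->.
Qed.

(** * Two-by-two matrices and products of idempotents *)

Section TwoByTwo.
Variable R : idomainType.
Implicit Types (A E M : 'M[R]_2) (r : 'rV[R]_2).

Lemma ord2P (i : 'I_2) : i = 0 \/ i = 1.
Proof.
by case: i => [[|[|m]] lti]; [left|right|]; rewrite ?ltnS //; apply: val_inj.
Qed.

Lemma mx2P A M :
  A 0 0 = M 0 0 -> A 0 1 = M 0 1 -> A 1 0 = M 1 0 -> A 1 1 = M 1 1 -> A = M.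
Proof.
move=> *; apply/matrixP => i j.
by have [->|->] := ord2P i; have [->|->] := ord2P j.
Qed.

Lemma mulmx2E m n (A : 'M[R]_(m, 2)) (B : 'M[R]_(2, n)) i j :
  (A *m B) i j = A i 0 * B 0 j + A i 1 * B 1 j.
Proof.
have l1 : lift ord0 ord0 = 1 :> 'I_2 by apply: val_inj.
by rewrite mxE big_ord_recl big_ord1 l1.
Qed.

Lemma det_mx22 A : \det A = A 0 0 * A 1 1 - A 0 1 * A 1 0.
Proof.
rewrite (expand_det_row _ 0) big_ord_recl big_ord1 /cofactor !det_mx11 !mxE /=.
have -> : lift ord0 ord0 = 1 :> 'I_2 by apply: val_inj.
have -> : lift 1 0 = 0 :> 'I_2 by apply: val_inj.
by rewrite expr0 expr1; ring.
Qed.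

Lemma idempotent_regular E :
  idempotent_mx E -> \det E != 0 -> E = 1.
Proof.
move=> idE dE; have d1 : \det E = 1.
  by apply: (mulfI dE); rewrite mulr1 -det_mulmx idE.
have uE : E \in unitmx by rewrite unitmxE d1 unitr1.
by rewrite -[LHS](mulKmx uE) idE mulVmx.
Qed.

(** Factors are stripped from the right: a regular idempotent is [1] and drops out, and the first
    singular one absorbs itself, [E * E = E]. The empty product is excluded by its determinant
    [1]. *)
Lemma singular_product_fixed A :
    is_product_of (@idempotent_mx R 2) A -> \det A = 0 ->
  exists2 E, \det E = 0 & A *m E = A.
Proof.
move=> [s idS ->] {A}; elim/last_ind: s idS => [|s E IHs] idS.
  by rewrite big_nil det1 => /eqP; rewrite oner_eq0.
have idE : idempotent_mx E by apply: idS; rewrite mem_rcons mem_head.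
rewrite -cats1 big_cat big_seq1 /=.
have [dE _|dE] := eqVneq (\det E) 0.
  by exists E => //; rewrite -[_ * E]/(_ *m E) -mulmxA idE.
rewrite (idempotent_regular idE dE) mulr1.
by apply: IHs => F Fs; apply: idS; rewrite mem_rcons in_cons Fs orbT.
Qed.

(** * Comparison of generators and the Prüfer property *)

Section IdempotentFactorization.
Hypothesis idem_factor : forall A,
  singular_mx A -> is_product_of (@idempotent_mx R 2) A.

Lemma top_row_factor r :
  is_product_of (@idempotent_mx R 2) (\matrix_(i, j) (if i == 0 then r 0 j else 0)).
Proof.
apply: idem_factor; rewrite /singular_mx.
by rewrite det_mx22 !mxE /= mulr0 mulr0 subrr.
Qed.

Lemma pair_comparison (a b : R) :
  exists e, (exists c, e * b = c * a) /\ (exists c, (1 - e) * a = c * b).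
Proof.
have fac := top_row_factor (\row_j (if j == 0 then a else b)).
have [|E dE AE] := singular_product_fixed fac.
  by rewrite det_mx22 !mxE /= mulr0 mulr0 subrr.
have e0 : a * E 0 0 + b * E 1 0 = a.
  by move/matrixP/(_ 0 0): AE; rewrite mulmx2E !mxE.
have e1 : a * E 0 1 + b * E 1 1 = b.
  by move/matrixP/(_ 0 1): AE; rewrite mulmx2E !mxE.
rewrite det_mx22 in dE.
(* The trace of [E] is found below by cancelling [a]. For [a = 0] the choice [e = 0] works, also for
   the zero pair, where [E] carries no information. *)
have [a0|a0] := eqVneq a 0.
  by exists 0; split; exists 0; rewrite ?a0; ring.
have tr : E 1 1 = 1 - E 0 0.
  apply: (mulfI a0).
  (* The added terms vanish by [e0], [e1] and [dE]; the whole sum expands to [a * (1 - E 0 0)]. *)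
  have -> : a * E 1 1 = a * E 1 1
     + (E 1 1 - 1) * (a * E 0 0 + b * E 1 0 - a)
     - E 1 0 * (a * E 0 1 + b * E 1 1 - b)
     - a * (E 0 0 * E 1 1 - E 0 1 * E 1 0).
    by rewrite e0 e1 dE !subrr; ring.
  by ring.
exists (E 0 0); split.
  have h : a * E 0 1 + b * (1 - E 0 0) - b = 0 by rewrite -tr e1 subrr.
  by exists (E 0 1); rewrite -[LHS]addr0 -h; ring.
have h : a - (a * E 0 0 + b * E 1 0) = 0 by rewrite e0 subrr.
by exists (E 1 0); rewrite -[RHS]addr0 -h; ring.
Qed.

Lemma partition_of_unity (a : nat -> R) n :
  exists e : nat -> R, \sum_(i < n.+1) e i = 1 /\
    forall i j, (i <= n)%N -> (j <= n)%N -> exists c, e i * a j = c * a i.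
Proof.
elim: n => [|n [e [e1 eP]]].
  exists (fun=> 1); split; first by rewrite big_ord1.
  by move=> [|//] [|//] _ _; exists 1.
have [x xP] := choice (fun i => pair_comparison (a i) (a n.+1)).
(* Each [e i] splits into [e i * x i], which stays at [i] and sends [a n.+1] into [a i R], and
   [e i * (1 - x i)], which sends every old [a j] through [a i] into [a n.+1 R]. The latter pieces
   are collected at the new index. *)
pose f := \sum_(i < n.+1) e i * (1 - x i).
exists (fun i => if i == n.+1 then f else e i * x i); split.
  rewrite big_ord_recr /= eqxx -big_split /= -[RHS]e1.
  by apply: eq_bigr => i _; rewrite (ltn_eqF (ltn_ord i)); ring.
move=> i j; rewrite leq_eqVlt => /orP[/eqP->|ltin].
  rewrite eqxx leq_eqVlt => /orP[/eqP->|ltjn]; first by exists f.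
  have h (k : 'I_n.+1) : exists c, e k * (1 - x k) * a j = c * a n.+1.
    have [c ec] := eP k j (ltn_ord k) ltjn; have [_ [d xd]] := xP k.
    by exists (c * d); rewrite mulrAC ec -!mulrA -xd (mulrC (a k)).
  have [d dP] := choice h.
  exists (\sum_k d k); rewrite !mulr_suml.
  by apply: eq_bigr => k _; rewrite dP.
rewrite (ltn_eqF ltin) leq_eqVlt => /orP[/eqP->|ltjn].
  have [[c xc] _] := xP i.
  by exists (e i * c); rewrite -mulrA xc mulrA.
have [c ec] := eP i j ltin ltjn.
by exists (c * x i); rewrite mulrAC ec mulrAC.
Qed.

Local Open Scope classical_set_scope.

Lemma prufer_of_idempotent_factor : prufer_domain R.
Proof.
move=> s sN0.
(* This nonzero generator serves as common denominator of the inverse ideal and forces [e i = 0]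
   wherever [s] has a zero entry. *)
have [k ks sk0] : exists2 k, (k < size s)%N & s`_k != 0.
  apply: contrapT => nk; apply: sN0; apply/seteqP; split => x /=.
    move=> [c ->]; apply: big1 => i _; apply/eqP; rewrite mulf_eq0.
    by apply/orP; right; apply/negPn/negP => si; apply: nk; exists i.
  by move=> ->; exists (fun=> 0); rewrite big1 // => i _; rewrite mul0r.
have [n sn] : exists n, size s = n.+1 by case: (size s) ks => [|n] // _; exists n.
have [e [e1]] := partition_of_unity (nth 0 s) n.
have ltS i : (i <= n)%N = (i < size s)%N by rewrite sn.
move=> eP; have sI i : (i < size s)%N -> fg_ideal s s`_i.
  move=> lis; exists (fun j => if j == Ordinal lis then 1 else 0).
  rewrite (bigD1 (Ordinal lis)) //= eqxx mul1r big1 ?addr0 // => j /negPf->.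
  by rewrite mul0r.
(* The inverse is the colon ideal of [R] by the given ideal, tested on generators. *)
pose J := [set t : {fraction R} | forall i, (i < size s)%N ->
  exists r : R, t * (s`_i)%:F = r%:F].
have JM t x : J t -> fg_ideal s x -> exists r : R, x%:F * t = r%:F.
  move=> Jt [c ->]; have h (i : 'I_(size s)) := Jt i (ltn_ord i).
  have [d dP] := choice h.
  exists (\sum_i c i * d i); rewrite !rmorph_sum mulr_suml.
  by apply: eq_bigr => i _; rewrite !rmorphM /= -dP; ring.
exists J.
  split; last first.
    exists s`_k => // x /(_ k ks)[r rP]; exists r; by rewrite mulrC.
  split.
  - by move=> i _; exists 0; rewrite mul0r rmorph0.
  - move=> x y Jx Jy i lis; have [r xr] := Jx i lis; have [q yq] := Jy i lis.
    by exists (r + q); rewrite mulrDl xr yq rmorphD.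
  - move=> r x Jx i lis; have [q xq] := Jx i lis.
    by exists (r * q); rewrite -mulrA xq rmorphM.
apply/seteqP; split => x /=.
  move=> [m [a [b [aI bJ ->]]]].
  have h i : exists r : R, a i * b i = r%:F.
    by have [y yI <-] := aI i; apply: JM.
  have [d dP] := choice h.
  by exists (\sum_i d i) => //; rewrite rmorph_sum; apply: eq_bigr => i _.
move=> [t _ <-].
pose p (i : nat) : {fraction R} := (e i)%:F / (s`_i)%:F.
have e0 i : (i < size s)%N -> s`_i = 0 -> e i = 0.
  move=> lis si0; have [||c] := eP i k; rewrite ?ltS //.
  by rewrite si0 mulr0 => /eqP; rewrite mulf_eq0 (negPf sk0) orbF => /eqP.
have pJ i : (i < size s)%N -> J (p i).
  move=> lis j ljs; have [si0|si0] := eqVneq s`_i 0.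
    by exists 0; rewrite /p e0 // rmorph0 !mul0r.
  have [||c ec] := eP i j; rewrite ?ltS //; exists c.
  rewrite /p mulrAC -rmorphM ec rmorphM mulfK //.
  by rewrite tofrac_eq0.
(* Each product of [s_i] and [p i] is [e i], even for [s_i = 0] by [e0]; so these products sum to
   [1], and [t] times this sum is [t]. *)
exists n.+1, (fun i => (s`_i)%:F), (fun i => t%:F * p i); split.
- by move=> i; exists s`_i => //; apply: sI; rewrite sn.
- move=> i j ljs; have [|q pq] := pJ i _ j ljs; first by rewrite sn.
  by exists (t * q); rewrite -mulrA pq rmorphM.
rewrite -[t in LHS]mulr1 -e1 mulr_sumr rmorph_sum; apply: eq_bigr => i _.
have [si0|si0] := eqVneq s`_i 0.
  by rewrite e0 ?sn // si0 mulr0 rmorph0 mul0r.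
rewrite /p rmorphM mulrCA; congr (_ * _).
by rewrite mulrC divfK // tofrac_eq0.
Qed.

End IdempotentFactorization.

(** * Products of elementary matrices and completion of rows *)

Local Notation GE2 := (is_product_of (@elementary_mx R 2)).

Lemma elementary_inv A :
  elementary_mx A -> exists2 M, elementary_mx M & A * M = 1.
Proof.
case=> [i j a nij | i j | i u uU].
- exists (1%:M + (- a) *: delta_mx i j); first exact: elementary_transvection.
  rewrite -[LHS]/(_ *m _) mulmxDl mul1mx mulmxDr mulmx1 -scalemxAl -scalemxAr.
  by rewrite mul_delta_mx_0 1?eq_sym // !scaler0 addr0 scaleNr addrNK.
- exists (tperm_mx i j); first exact: elementary_swap.
  by rewrite -[LHS]/(_ *m _) -perm_mxM tperm2 perm_mx1.
- exists (diag_mx (\row_k (if k == i then u^-1 else 1))).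
    by apply: elementary_dilation; rewrite unitrV.
  rewrite -[LHS]/(_ *m _) mulmx_diag; apply/matrixP => j k; rewrite !mxE.
  by case: (j == i); rewrite ?mulrV ?mulr1.
Qed.

Lemma GE2_inv A : GE2 A -> exists2 M, GE2 M & A * M = 1 /\ M * A = 1.
Proof.
move=> [s]; elim: s A => [|E s IHs] A elS ->.
  by exists 1; [exact: is_product_of1 | rewrite big_nil mulr1].
have [|M GM [AM MA]] := IHs _ _ erefl.
  by move=> F Fs; apply: elS; rewrite in_cons Fs orbT.
have [F elF EF] := elementary_inv (elS E (mem_head _ _)).
have FE : F * E = 1 by apply: mulmx1C.
exists (M * F); first exact/is_product_of_mul/is_product_of_gen.
rewrite big_cons; split.
  by rewrite mulrA -(mulrA E) AM mulr1.
by rewrite mulrA -(mulrA M) FE mulr1.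
Qed.

(** This shape remains once the first row of an invertible matrix is reduced to [(1, 0)]; it is a
    transvection times a dilation. *)
Lemma GE2_lower (x d : R) : d \is a GRing.unit ->
  GE2 (\matrix_(i, j) (if i == 0 then (j == 0)%:R else if j == 0 then x else d)).
Proof.
move=> dU.
have -> : (\matrix_(i, j) (if i == 0 then (j == 0)%:R else if j == 0 then x else d))
   = (1%:M + x *: delta_mx 1 0) * diag_mx (\row_k (if k == 1 then d else 1)) :> 'M[R]_2.
  rewrite -[RHS]/(_ *m _).
  by apply: mx2P; rewrite mulmx2E !mxE /=; ring.
apply: is_product_of_mul; apply: is_product_of_gen.
  exact: elementary_transvection.
exact: elementary_dilation.
Qed.

Definition completable r := exists2 M, GE2 M & r = delta_mx 0 0 *m M.

Lemma completable_step r r' (c : 'cV[R]_2) :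
  completable r -> r *m c = 1%:M -> r' *m c = 1%:M -> completable r'.
Proof.
move=> [M GM ->] rc r'c; have [M' GM' [MM' M'M]] := GE2_inv GM.
have [d dE] : exists d, d = M *m c by exists (M *m c).
(* [r c = 1] says that [d = M c] has top entry [1], so [d] is the first column of [L], and [c] that
   of [M' L]. *)
pose L : 'M[R]_2 := 1%:M + d 1 0 *: delta_mx 1 0.
have GL : GE2 L by apply: is_product_of_gen; apply: elementary_transvection.
have dL : d = L *m delta_mx 0 0.
  have d0 : d 0 0 = 1.
    move/matrixP/(_ 0 0): rc; rewrite -mulmxA -dE mulmx2E !mxE /=.
    by rewrite mul1r mul0r addr0.
  apply/colP => i; rewrite /L mulmx2E !mxE.
  by have [->|->] := ord2P i; rewrite /= ?d0; ring.
have cL : c = M' *m L *m delta_mx 0 0.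
  by rewrite -mulmxA -dL dE mulmxA [M' *m M]M'M mul1mx.
have [N' GN' [NN' _]] := GE2_inv (is_product_of_mul GM' GL).
have [q qE] : exists q, q = r' *m (M' *m L) by exists (r' *m (M' *m L)).
(* Dually, [r' c = 1] says that [q] starts with [1], so it is the first row of [U]; undoing [M' L]
   recovers [r']. *)
pose U : 'M[R]_2 := 1%:M + q 0 1 *: delta_mx 0 1.
have qU : q = delta_mx 0 0 *m U.
  have q0 : q 0 0 = 1.
    move/matrixP/(_ 0 0): r'c; rewrite cL mulmxA -qE mulmx2E !mxE /=.
    by rewrite mulr1 mulr0 addr0.
  apply/rowP => j; rewrite /U mulmx2E !mxE.
  by have [->|->] := ord2P j; rewrite /= ?q0; ring.
exists (U * N').
  apply: is_product_of_mul => //; apply: is_product_of_gen.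
  exact: elementary_transvection.
by rewrite -[U * N']/(U *m N') mulmxA -qU qE -mulmxA [_ *m N']NN' mulmx1.
Qed.

Lemma idempotent_chain (s : seq 'M[R]_2) r (u : 'cV[R]_2) :
    (forall E, E \in s -> idempotent_mx E) -> completable r ->
    r *m (\prod_(E <- s) E) *m u = 1%:M ->
  completable (r *m \prod_(E <- s) E).
Proof.
elim: s r => [|E s IHs] r idS cr; first by rewrite big_nil mulmx1.
rewrite big_cons -[E * _]/(E *m _) mulmxA => ru.
apply: IHs => //; first by move=> F Fs; apply: idS; rewrite in_cons Fs orbT.
have idE : idempotent_mx E by apply: idS; rewrite mem_head.
(* Because [E * E = E], this column pairs to [1] with both [r] and [r E]. *)
apply: (completable_step (c := E *m (\prod_(F <- s) F *m u)) cr).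
  by rewrite !mulmxA.
by rewrite !mulmxA -(mulmxA r) idE.
Qed.

End TwoByTwo.

Theorem corollary3p5 (R : idomainType)
    (idem_factor : forall A : 'M[R]_2,
       singular_mx A -> is_product_of (@idempotent_mx R 2) A) :
  prufer_domain R /\
  (forall A : 'M[R]_2,
     A \in unitmx -> is_product_of (@elementary_mx R 2) A).
Proof.
split; first exact: prufer_of_idempotent_factor.
move=> A uA.
have [s idS sA] := top_row_factor idem_factor (row 0 A).
have rA : row 0 A = delta_mx 0 0 *m \prod_(E <- s) E.
  rewrite -sA; apply/rowP => j; rewrite mulmx2E !mxE /= mul1r mul0r addr0.
  by [].
have [M GM rM] : completable (row 0 A).
  rewrite rA; apply: (idempotent_chain (u := col 0 (invmx A))) => //.
    by exists 1; [exact: is_product_of1 | rewrite mulmx1].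
  by rewrite -rA colE mulmxA -row_mul mulmxV // -colE; apply/matrixP=> i j; rewrite !mxE !ord1.
have [M' GM' [MM' M'M]] := GE2_inv GM.
(* [A] and [M] share their first row, so [B] has first row [(1, 0)], and its entry [B 1 1] equals
   [\det B], a unit. *)
have [B BE] : exists B, B = A *m M' by exists (A *m M').
have uB : B \in unitmx.
  by rewrite BE unitmx_mul uA; case: (mulmx1_unit MM').
have b0 j : B 0 j = (j == 0)%:R.
  have : row 0 B = delta_mx 0 0 by rewrite BE row_mul rM -mulmxA [M *m _]MM' mulmx1.
  by move/rowP/(_ j); rewrite !mxE.
have -> : A = B * M by rewrite BE -[_ * M]/(_ *m M) -mulmxA [M' *m M]M'M mulmx1.
apply: is_product_of_mul GM.
have -> : B = \matrix_(i, j) (if i == 0 then (j == 0)%:R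
    else if j == 0 then B 1 0 else B 1 1).
  by apply: mx2P; rewrite [RHS]mxE ?b0.
apply: GE2_lower.
by move: uB; rewrite unitmxE det_mx22 !b0 /= mul1r mul0r subr0.
Qed.
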